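(* Let $K$ be a quadratic field with embeddings into $\mathbb{R}$ and $\mathbb{Q}_2$, let $\alpha\in K$, and let $\{p_n/q_n\}$ be the convergents of $\alpha$ obtained from the algorithm described in the context. Then, in $\mathbb{R}$, $$\alpha_\infty=\lim_{n\to\infty}\frac{p_n}{q_n}.$$
   Context: $K$ is a quadratic field with fixed field embeddings $\sigma_\infty:K\to\mathbb{R}$ and $\sigma_2:K\to\mathbb{Q}_2$. For $\alpha\in K$ write $\alpha_\infty=\sigma_\infty(\alpha)$, $\alpha_{\langle 2\rangle}=\sigma_2(\alpha)$. For $u=\sum_{n}c_n2^n\in\mathbb{Q}_2$ with digits $c_n\in\{0,1\}$ ($c_n=0$ for $n<v_2(u)$), put $\lfloor u\rfloor_2=\sum_{n\le 0}c_n2^n\in\mathbb{Z}[1/2]$. For $\alpha\in K$ let $b^{(0)}(\alpha)=2m+\lfloor\alpha_{\langle 2\rangle}\rfloor_2$, where $m$ is the smallest among the integers $i$ minimizing $|\alpha_\infty-2i-\lfloor\alpha_{\langle 2\rangle}\rfloor_2|$; let $b^{(1)}(\alpha)=m'+\lfloor\alpha_{\langle 2\rangle}\rfloor_2$, where $m'$ is the smallest among the integers $i$ minimizing $|\alpha_\infty-i-\lfloor\alpha_{\langle 2\rangle}\rfloor_2|$. For $\epsilon\in\{0,1\}$ let $F_{2,\epsilon}(\alpha)=\frac{1}{\alpha-b^{(\epsilon)}(\alpha)}$, undefined if $\alpha=b^{(\epsilon)}(\alpha)$. Algorithm: $\alpha_0=\alpha$; for $n\ge0$ put $\epsilon=0$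 if $n$ is even and $\epsilon=1$ if $n$ is odd, $b_n(\alpha)=b^{(\epsilon)}(\alpha_n)$ and $\alpha_{n+1}=F_{2,\epsilon}(\alpha_n)$; the algorithm halts if $F_{2,\epsilon}(\alpha_n)$ is undefined. Convergents: $p_{-1}=1$, $q_{-1}=0$ and, for $n\ge0$ (as long as $b_n(\alpha)$ is defined), $$\begin{pmatrix} p_n & p_{n-1} \\ q_n & q_{n-1} \end{pmatrix}=\begin{pmatrix} b_0(\alpha) & 1 \\ 1 & 0 \end{pmatrix}\cdots\begin{pmatrix} b_n(\alpha) & 1 \\ 1 & 0 \end{pmatrix}.$$ One has $q_n\neq0$ for all such $n\ge0$. If the algorithm halts (as happens for $\alpha\in\mathbb{Q}$), so that there are only finitely many convergents $p_0/q_0,\dots,p_N/q_N$, the limit is understood as the last convergent $p_N/q_N$. *)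

(* Defs.v *)
From HB Require Import structures.
From mathcomp Require Import all_boot all_order all_algebra all_field.
From mathcomp Require Import zify ring lra.
From mathcomp Require Import boolp classical_sets reals topology normedtype.
From mathcomp Require Import sequences.

Set Implicit Arguments.
Unset Strict Implicit.
Unset Printing Implicit Defensive.

Import Order.TTheory GRing.Theory Num.Theory.
Import numFieldNormedType.Exports.

Local Open Scope classical_set_scope.
Local Open Scope ring_scope.

(* Z_2 is the inverse limit of the rings Z/2^n. The component [residue x n] is
   the representative in [0, 2^n) of the class of x modulo 2^n; the bounds
   follow from the compatibility condition, (m %% d)%Z being nonnegative. *)
Record Z2 := MkZ2 {
  residue : nat -> int;
  residueE : forall n, residue n = (residue n.+1 %% 2 ^+ n)%Z }.

HB.instance Definition _ := gen_eqMixin Z2.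
HB.instance Definition _ := gen_choiceMixin Z2.

Lemma residue_inj (x y : Z2) : (forall n, residue x n = residue y n) -> x = y.
Proof.
case: x => f hf; case: y => g hg /= /funext fg; case: g / fg hg => hg.
by congr MkZ2; apply: Prop_irrelevance.
Qed.

Lemma residue_mod (x : Z2) n : (residue x n %% 2 ^+ n)%Z = residue x n.
Proof. by rewrite residueE modz_mod. Qed.

Definition compatible (f : nat -> int) :=
  forall n, (f n = f n.+1 %[mod 2 ^+ n])%Z.

Lemma modz_pow2 (a : int) n : ((a %% 2 ^+ n.+1)%Z = a %[mod 2 ^+ n])%Z.
Proof.
rewrite {2}(divz_eq a (2 ^+ n.+1)) exprS mulrA -exprS.
by rewrite modzMDl.
Qed.

Lemma compatible_residue f : compatible f ->
  forall n, (f n %% 2 ^+ n)%Z = ((f n.+1 %% 2 ^+ n.+1)%Z %% 2 ^+ n)%Z.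
Proof. by move=> hf n; rewrite modz_pow2 hf. Qed.

Definition Z2_of f (hf : compatible f) := MkZ2 (compatible_residue hf).

Lemma residue_compatible (x : Z2) : compatible (residue x).
Proof. by move=> n; rewrite residue_mod -residueE. Qed.

Lemma Z2_int_subproof (a : int) : compatible (fun=> a).
Proof. by []. Qed.

Lemma Z2_add_subproof (x y : Z2) :
  compatible (fun n => residue x n + residue y n).
Proof.
by move=> n; rewrite -modzDm !residue_compatible modzDm.
Qed.

Lemma Z2_opp_subproof (x : Z2) : compatible (fun n => - residue x n).
Proof. by move=> n; rewrite -modzNm residue_compatible modzNm. Qed.

Lemma Z2_mul_subproof (x y : Z2) :
  compatible (fun n => residue x n * residue y n).
Proof.
by move=> n; rewrite -modzMm !residue_compatible modzMm.
Qed.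

Definition Z2_int a := Z2_of (Z2_int_subproof a).
Definition Z2_add x y := Z2_of (Z2_add_subproof x y).
Definition Z2_opp x := Z2_of (Z2_opp_subproof x).
Definition Z2_mul x y := Z2_of (Z2_mul_subproof x y).

Lemma Z2_addA : associative Z2_add.
Proof.
by move=> x y z; apply: residue_inj => n /=; rewrite modzDmr modzDml addrA.
Qed.

Lemma Z2_addC : commutative Z2_add.
Proof. by move=> x y; apply: residue_inj => n /=; rewrite addrC. Qed.

Lemma Z2_add0 : left_id (Z2_int 0) Z2_add.
Proof.
by move=> x; apply: residue_inj => n /=; rewrite modzDml add0r residue_mod.
Qed.

Lemma Z2_addN : left_inverse (Z2_int 0) Z2_opp Z2_add.
Proof.
by move=> x; apply: residue_inj => n /=; rewrite modzDml addNr.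
Qed.

HB.instance Definition _ :=
  GRing.isZmodule.Build Z2 Z2_addA Z2_addC Z2_add0 Z2_addN.

Lemma Z2_mulA : associative Z2_mul.
Proof.
by move=> x y z; apply: residue_inj => n /=; rewrite modzMmr modzMml mulrA.
Qed.

Lemma Z2_mulC : commutative Z2_mul.
Proof. by move=> x y; apply: residue_inj => n /=; rewrite mulrC. Qed.

Lemma Z2_mul1 : left_id (Z2_int 1) Z2_mul.
Proof.
by move=> x; apply: residue_inj => n /=; rewrite modzMml mul1r residue_mod.
Qed.

Lemma Z2_mulDl : left_distributive Z2_mul +%R.
Proof.
by move=> x y z; apply: residue_inj => n /=; rewrite modzMml mulrDl modzDm.
Qed.

Lemma Z2_one_neq0 : Z2_int 1 != 0.
Proof. by apply/eqP => /(congr1 (residue^~ 1%N)). Qed.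

HB.instance Definition _ := GRing.Zmodule_isComNzRing.Build Z2
  Z2_mulA Z2_mulC Z2_mul1 Z2_mulDl Z2_one_neq0.

Definition Z2_unit : pred Z2 := fun x => `[< exists y, y * x = 1 >].
Definition Z2_inv (x : Z2) : Z2 :=
  if Z2_unit x then xget 0 [set y | y * x = 1] else x.

Lemma Z2_mulV : {in Z2_unit, left_inverse 1 Z2_inv *%R}.
Proof.
move=> x; rewrite -topredE /= /Z2_inv => ux; rewrite ux.
by move/asboolP: ux; exact: (@xgetPex _ 0 [set y | y * x = 1]).
Qed.

Lemma Z2_unitP (x y : Z2) : y * x = 1 -> Z2_unit x.
Proof. by move=> yx1; apply/asboolP; exists y. Qed.

Lemma Z2_inv_out : {in [predC Z2_unit], Z2_inv =1 id}.
Proof. by move=> x; rewrite !inE /Z2_inv => /negbTE; rewrite -topredE /= => ->. Qed.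

HB.instance Definition _ := GRing.ComNzRing_hasMulInverse.Build Z2
  Z2_mulV Z2_unitP Z2_inv_out.

Lemma residueM (x y : Z2) n :
  residue (x * y) n = (residue x n * residue y n %% 2 ^+ n)%Z.
Proof. by []. Qed.

Lemma residueD (x y : Z2) n :
  residue (x + y) n = ((residue x n + residue y n) %% 2 ^+ n)%Z.
Proof. by []. Qed.

Lemma residue_leq (x : Z2) m n : (m <= n)%N ->
  (residue x n %% 2 ^+ m)%Z = residue x m.
Proof.
move=> /subnK <-; elim: (n - m)%N => [|k IHk]; first exact: residue_mod.
have -> : residue x (k.+1 + m) = residue x (k + m)
    + (residue x (k.+1 + m) %/ 2 ^+ (k + m))%Z * 2 ^+ k * 2 ^+ m.
  by rewrite [residue x (k + m)]residueE -mulrA -exprD addrC -divz_eq.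
by rewrite addrC modzMDl.
Qed.

Lemma Z2_neq0 (x : Z2) : x != 0 ->
  exists a, exists2 u, residue x a.+1 = 2 ^+ a * u & ~~ (2 %| u)%Z.
Proof.
move=> x0; have [n] : exists n, residue x n != 0.
  apply: contrapT => h; case/eqP: x0; apply: residue_inj => n /=.
  by rewrite mod0z; apply: contrapT => xn; apply: h; exists n; apply/eqP.
move=> xn; have ex : exists n, residue x n != 0 by exists n.
case: (ex_minnP ex) => [[|a]].
  by rewrite residueE expr0 modz1.
move=> xa min; have xa0 : residue x a = 0.
  by apply/eqP; apply/negPn; apply/negP => /min; rewrite ltnn.
have /dvdzP[u xau] : (2 ^+ a %| residue x a.+1)%Z.
  by apply/dvdz_mod0P; rewrite residue_leq.
exists a, u; first by rewrite xau mulrC.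
apply: contra xa => /dvdzP[v uv].
by rewrite -residue_mod xau uv -mulrA -exprS modzMl.
Qed.

Lemma Z2_integral : GRing.integral_domain_axiom Z2.
Proof.
move=> x y xy0; apply: contrapT => /negP; rewrite negb_or => /andP[].
move=> /Z2_neq0[a [u xa u2]] /Z2_neq0[b [v yb v2]].
have oddP (w : int) : ~~ (2 %| w)%Z -> exists k, w = 2 * k + 1.
  rewrite dvdzE /= => w2; exists (w %/ 2)%Z; rewrite {1}(divz_eq w 2).
  have := modz_ge0 w (isT : 2 != 0 :> int); have := ltz_pmod w (isT : 0 < 2 :> int).
  have : (w %% 2)%Z != 0 by apply: contra w2 => /eqP/dvdz_mod0P; rewrite dvdzE.
  by lia.
have mulE (z : Z2) c w : residue z c.+1 = 2 ^+ c * w ->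
    exists k, residue z (a + b).+1 = 2 ^+ c * w + 2 ^+ c.+1 * k \/ (a + b < c)%N.
  move=> zc; case: (leqP c (a + b)) => cab; last by exists 0; right.
  exists (residue z (a + b).+1 %/ 2 ^+ c.+1)%Z; left.
  by rewrite {1}(divz_eq (residue z _) (2 ^+ c.+1)) residue_leq // zc addrC [in RHS](mulrC (2 ^+ c.+1)).
have [k [xk|]] := mulE x a u xa; last by lia.
have [l [yl|]] := mulE y b v yb; last by lia.
have : (residue (x * y) (a + b).+1 == 0) by rewrite xy0 /= mod0z.
rewrite residueM xk yl => /eqP/dvdz_mod0P/dvdzP[q].
have [s us] := oddP _ u2; have [t vt] := oddP _ v2.
rewrite us vt !exprS exprD.
set A := 2 ^+ a; set B := 2 ^+ b => e.
have : A * B * ((2 * s + 1 + 2 * k) * (2 * t + 1 + 2 * l)) = A * B * (2 * q).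
  by rewrite mulrCA [in RHS]mulrA; lia.
have AB0 : A * B != 0 by rewrite mulf_neq0 // expf_neq0.
by move=> /(mulfI AB0); lia.
Qed.

HB.instance Definition _ := GRing.ComUnitRing_isIntegral.Build Z2 Z2_integral.

Lemma Z2_intE (a : int) : a%:~R = Z2_int a.
Proof.
have natE (n : nat) : n%:R = Z2_int n.
  elim: n => [//|n IHn]; rewrite -addn1 natrD IHn.
  by apply: residue_inj => m /=; rewrite modzDm -PoszD.
case: a => n; rewrite ?NegzE ?mulrNz -pmulrn natE //.
by apply: residue_inj => m /=; rewrite modzNm.
Qed.

Lemma residue_int (a : int) n : residue a%:~R n = (a %% 2 ^+ n)%Z.
Proof. by rewrite Z2_intE. Qed.

Lemma modz_pMr (p m d : int) : 0 < p -> (m * p %% (d * p))%Z = (m %% d)%Z * p.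
Proof. by move=> p0; rewrite /modz divzMpr // mulrBl mulrA. Qed.

Lemma residue_eq0 (x : Z2) n : residue x n = 0 -> exists y, x = 2 ^+ n * y.
Proof.
move=> xn.
have dvd m : residue x (m + n) = (residue x (m + n) %/ 2 ^+ n)%Z * 2 ^+ n.
  by rewrite divzK //; apply/dvdz_mod0P; rewrite residue_leq ?leq_addl.
have p0 m : 2 ^+ m != 0 :> int by rewrite expf_neq0.
have cpt : compatible (fun m => residue x (m + n) %/ 2 ^+ n)%Z.
  move=> m; have := residueE x (m + n).
  rewrite -addSn {1}(dvd m) {1}(dvd m.+1) exprD modz_pMr ?exprn_gt0 //.
  by move=> /(mulIf (p0 n)) ->; rewrite modz_mod.
exists (Z2_of cpt); apply: residue_inj => m.
have -> : 2 ^+ n = (2 ^+ n)%:~R :> Z2 by rewrite rmorphXn.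
rewrite residueM residue_int /= modzMm mulrC -dvd.
by rewrite residue_leq ?leq_addr.
Qed.

Lemma residue_dvd (x y : Z2) n : residue (2 ^+ n * x + y) n = residue y n.
Proof.
have -> : 2 ^+ n = (2 ^+ n)%:~R :> Z2 by rewrite rmorphXn.
by rewrite residueD residueM residue_int modzMml modzMr add0r residue_mod.
Qed.

Lemma Z2_odd_unit (x : Z2) : residue x 1 = 1 -> exists y, y * x = 1.
Proof.
move=> x1; have [t xt] : exists t, x = 1 - 2 * t.
  have [|t xt] := @residue_eq0 (1 - x) 1.
    rewrite residueD [residue (- x) 1]/= modzDmr x1 -[1]/(1%:~R : Z2).
    by rewrite residue_int.
  by exists t; rewrite -[2]expr1 -xt; ring.
have cpt : compatible (fun n => residue (\sum_(i < n) (2 * t) ^+ i) n).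
  move=> n; rewrite residue_mod [RHS]residue_leq // big_ord_recr /= addrC exprMn.
  by rewrite -residueD residue_dvd.
exists (Z2_of cpt); apply: residue_inj => n.
rewrite residueM /= modzMml -residueM xt.
have -> : (\sum_(i < n) (2 * t) ^+ i) * (1 - 2 * t) = 2 ^+ n * (- t ^+ n) + 1.
  rewrite mulrC -[1 - _]opprB mulNr -subrX1 exprMn; ring.
by rewrite residue_dvd.
Qed.

Lemma Z2_factor (x : Z2) : x != 0 ->
  exists a y z, [/\ x = 2 ^+ a * y, z * y = 1 & residue y 1 = 1].
Proof.
move=> /Z2_neq0[a [u xa u2]].
have [|y xy] := @residue_eq0 x a.
  by rewrite residueE xa mulrC modzMl.
have y1 : residue y 1 = 1.
  have : residue y 1 != 0.
    apply/eqP => /residue_eq0[w yw]; case/negP: u2.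
    have : residue x a.+1 = 0.
      rewrite xy yw mulrA -exprD addn1 -[_ * w]addr0 residue_dvd.
      exact: mod0z.
    move=> /eqP; rewrite xa mulf_eq0 expf_eq0 /= andbF => /eqP ->; exact: dvdz0.
  have := residue_mod y 1; rewrite expr1.
  have := modz_ge0 (residue y 1) (isT : 2 != 0 :> int).
  have := ltz_pmod (residue y 1) (isT : 0 < 2 :> int).
  lia.
by have [z zy] := Z2_odd_unit y1; exists a, y, z.
Qed.

Notation Q2 := {fraction Z2}.
Local Notation "z %:F" := (@tofrac Z2 z).

Definition digit_sum (F : fieldType) (c : int -> bool) (k N : nat) : F :=
  \sum_(j < N) (c (j%:Z - k%:Z))%:R * 2 ^ (j%:Z - k%:Z).

(* c lists the digits of u: c_n = 0 for n < - k and u is the sum of the series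
   c_n 2^n in Q_2, where the sets 2^M Z_2 form a basis of neighbourhoods of 0;
   [digit_sum F c k N] is the partial sum of its terms - k <= n < N - k. *)
Definition digits_of (u : Q2) (c : int -> bool) (k : nat) : Prop :=
  (forall n : int, n < - k%:Z -> c n = false) /\
  forall M : nat, exists N0 : nat, forall N : nat, (N0 <= N)%N ->
    exists z : Z2, u - digit_sum Q2 c k N = 2 ^+ M * z%:F.

(* The digits of index <= 0 are c_n for - k <= n < k.+1 - k. *)
Definition is_floor2 (u : Q2) (r : rat) : Prop :=
  exists c k, digits_of u c k /\ r = digit_sum rat c k k.+1.

Definition floor2 (u : Q2) : rat := xget 0 [set r | is_floor2 u r].

Lemma pow2_nat n : (2 ^ n)%N%:Z = 2 ^+ n.
Proof. by rewrite -[RHS]natrX natz. Qed.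

Lemma tofrac2X n : (2 ^+ n : Z2)%:F = 2 ^+ n.
Proof. by rewrite rmorphXn rmorph_nat. Qed.

Lemma Z2_int_eq0 (a : int) : (a%:~R == 0 :> Z2) = (a == 0).
Proof.
apply/eqP/eqP => [a0|->//].
have /dvdz_mod0P : (a %% 2 ^+ `|a|)%Z = 0 by rewrite -residue_int a0 /= mod0z.
rewrite dvdzE abszX /=; case: (posnP `|a|%N) => [|a1 /(dvdn_leq a1)]; first by lia.
by rewrite leqNgt ltn_expl.
Qed.

Lemma Z2_2neq0 : 2 != 0 :> Z2.
Proof. by rewrite (Z2_int_eq0 2). Qed.

Lemma Q2_2neq0 : 2 != 0 :> Q2.
Proof. by rewrite -[2](@rmorph_nat _ _ (@tofrac Z2)) tofrac_eq0 Z2_2neq0. Qed.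

Definition digit_nat (c : int -> bool) (k N : nat) : nat :=
  \sum_(j < N) (c (j%:Z - k%:Z)%R * 2 ^ j)%N.

Lemma digit_sumE (F : fieldType) c k N : 2 != 0 :> F ->
  digit_sum F c k N = (digit_nat c k N)%:R / 2 ^+ k.
Proof.
move=> F2; rewrite natr_sum mulr_suml; apply: eq_bigr => j _.
by rewrite natrM natrX -mulrA expfzDr // -exprnN.
Qed.

Lemma digit_nat_lt c k N : (digit_nat c k N < 2 ^ N)%N.
Proof.
elim: N => [|N IHN]; first by rewrite /digit_nat big_ord0.
rewrite /digit_nat big_ord_recr /= -/(digit_nat c k N) expnS.
by case: (c _); lia.
Qed.

Lemma digit_nat_cat c k M N : (M <= N)%N ->
  exists q, digit_nat c k N = (digit_nat c k M + 2 ^ M * q)%N.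
Proof.
move=> /subnK <-; elim: (N - M)%N => [|m [q qE]]; first by exists 0%N; rewrite muln0 addn0.
exists (q + c ((m + M)%:Z - k%:Z)%R * 2 ^ m)%N.
rewrite addSn /digit_nat big_ord_recr /= -/(digit_nat c k (m + M)) qE.
by rewrite expnD mulnDr addnA [(2 ^ M * (_ * _))%N]mulnCA (mulnC (2 ^ M)%N (2 ^ m)%N).
Qed.

Lemma digits_tail (F : fieldType) (K L a q t : F) : K != 0 ->
  L * t + (a + L * q) / K - a / K = L / K * (K * t + q).
Proof. by move=> K0; field. Qed.

Lemma digits_ofE u c k N : digits_of u c k ->
  exists z : Z2, u - digit_sum Q2 c k N = 2 ^+ N / 2 ^+ k * z%:F.
Proof.
move=> [_ /(_ N)[N0 /(_ (maxn N0 N))[|z uz]]]; first exact: leq_maxl.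
have [q] := @digit_nat_cat c k N (maxn N0 N) (leq_maxr _ _).
move: uz; rewrite !digit_sumE ?Q2_2neq0 // => uz qE.
exists (2 ^+ k * z + q%:R); rewrite rmorphD rmorphM /= tofrac2X rmorph_nat.
move: uz; rewrite qE natrD natrM natrX => /eqP; rewrite subr_eq => /eqP ->.
by apply: digits_tail; apply: expf_neq0 Q2_2neq0.
Qed.

Lemma fraction_ex (R : idomainType) (u : {fraction R}) :
  exists x, exists2 y, y != 0 & u = tofrac x / tofrac y.
Proof.
elim/quotW: u => r; have r0 := denom_ratioP r.
exists \n_r, \d_r => //.
apply: (canRL (mulfK _)); first by rewrite tofrac_eq0.
unlock tofrac. rewrite -[_ * _]/(FracField.mul _ _).
rewrite !piE /=. apply/eqmodP. rewrite /= /FracField.mulf.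
rewrite FracField.equivfE.
rewrite !numden_Ratio ?mulf_neq0 ?oner_neq0 //.
by rewrite !mulr1 mulrC.
Qed.

Lemma frac_unit (F : fieldType) (x y v w A : F) : v * w = 1 -> y = A * w ->
  x / y = x * v / A.
Proof.
move=> vw ->; have w0 : w != 0.
  by apply: contraTneq (oner_neq0 F) => w0; rewrite -vw w0 mulr0 eqxx.
by rewrite -[v](mulfK w0) vw mul1r invfM; rewrite mulrA mulrAC.
Qed.

Lemma digits_ex u : exists c k, digits_of u c k.
Proof.
have [x [k ux]] : exists (x : Z2) k, u = x%:F / 2 ^+ k.
  have [x [y y0 ->]] := fraction_ex u.
  have [a [w [v [yw vw _]]]] := Z2_factor y0.
  exists (x * v), a; rewrite rmorphM /=.
  apply: (@frac_unit _ _ _ _ (tofrac w)); first by rewrite -rmorphM vw rmorph1.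
  by rewrite yw rmorphM /= tofrac2X.
pose d j := residue x j.+1 != residue x j.
pose c (n : int) := if n + k%:Z is Posz j then d j else false.
exists c, k; split=> [n nk|M].
  by rewrite /c; case nj: (n + k%:Z) => [j|j] //; exfalso; lia.
have rge N : 0 <= residue x N.
  by rewrite -residue_mod modz_ge0 ?expf_neq0.
have rlt N : residue x N < (2 ^ N)%N.
  by rewrite -residue_mod pow2_nat ltz_pmod ?exprn_gt0.
have xE N : residue x N = digit_nat c k N.
  elim: N => [|N IHN].
    by rewrite /digit_nat big_ord0 residueE expr0 modz1.
  rewrite /digit_nat big_ord_recr /= -/(digit_nat c k N) PoszD -IHN.
  rewrite /c subrK /d.
  have := divz_eq (residue x N.+1) (2 ^ N)%N; rewrite pow2_nat -residueE -pow2_nat.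
  move: (rge N.+1) (rlt N.+1) (rge N) (rlt N).
  move: (residue x N.+1) (residue x N) => r s; rewrite expnS.
  set P := (2 ^ N)%N; set q := (_ %/ _)%Z => r0 rP s0 sP rE.
  have q2 : q < 2 by move: rP; rewrite rE; nia.
  have q0 : 0 <= q by move: r0; rewrite rE; nia.
  have [qE|qE] : q = 0 \/ q = 1 by lia.
    by move: rE; rewrite qE mul0r add0r => ->; rewrite eqxx; lia.
  by move: rE; rewrite qE mul1r => ->; case: eqP; lia.
exists (M + k)%N => N MkN.
have [|z xz] := @residue_eq0 (x - (residue x N)%:~R) N.
  rewrite residueD -rmorphN residue_int modzDmr subrr; exact: mod0z.
exists (2 ^+ (N - k - M) * z).
rewrite digit_sumE ?Q2_2neq0 // ux -mulrBl.
have -> : x%:F - (digit_nat c k N)%:R = (x - (residue x N)%:~R)%:F.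
  by rewrite rmorphB /= xE rmorph_nat.
rewrite xz !rmorphM /= !tofrac2X.
have -> : 2 ^+ N = 2 ^+ M * 2 ^+ (N - k - M) * 2 ^+ k :> Q2.
  by rewrite -!exprD; congr (_ ^+ _); lia.
by rewrite mulrAC mulfK -?mulrA //; apply: expf_neq0 Q2_2neq0.
Qed.

Lemma floor2_ex u : exists r, is_floor2 u r.
Proof.
have [c [k uc]] := digits_ex u.
by exists (digit_sum rat c k k.+1), c, k.
Qed.

Lemma is_floor2E u r : is_floor2 u r -> exists k a, exists2 z : Z2,
  (a < 2 ^ k.+1)%N /\ r = a%:R / 2 ^+ k & u - a%:R / 2 ^+ k = 2 * z%:F.
Proof.
move=> [c [k [uc ->]]]; have [z uz] := digits_ofE k.+1 uc.
exists k, (digit_nat c k k.+1), z; first by rewrite digit_nat_lt digit_sumE.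
rewrite -digit_sumE ?Q2_2neq0 // uz exprS mulfK //.
by apply: expf_neq0 Q2_2neq0.
Qed.

Lemma sub_frac (F : fieldType) (a b K L u t s : F) : K != 0 -> L != 0 ->
  u - a / K = 2 * t -> u - b / L = 2 * s -> a * L - b * K = 2 * K * L * (s - t).
Proof.
move=> K0 L0 ut us; have st : 2 * (s - t) = a / K - b / L.
  by rewrite mulrBr -ut -us; ring.
have -> : 2 * K * L * (s - t) = K * L * (2 * (s - t)) by ring.
by rewrite st; field; rewrite K0 L0.
Qed.

Lemma floor2_uniq u r s : is_floor2 u r -> is_floor2 u s -> r = s.
Proof.
move=> /is_floor2E[k [a [z [ak ->] uz]]] /is_floor2E[l [b [w [bl ->] uw]]].
have p0 n : 2 ^+ n != 0 :> Q2 by apply: expf_neq0 Q2_2neq0.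
have h := sub_frac (p0 k) (p0 l) uz uw.
have : ((a * 2 ^ l)%N%:Z - (b * 2 ^ k)%N%:Z)%:~R = 2 ^+ (k + l).+1 * (w - z).
  apply/eqP; rewrite -tofrac_eq; apply/eqP.
  rewrite rmorph_int [RHS]rmorphM [X in _ * X]rmorphB /= tofrac2X exprS exprD.
  by rewrite mulrA -h intrB -!pmulrn !natrM !natrX.
move=> /(congr1 (fun x => residue x (k + l).+1)).
rewrite residue_int -[_ * (w - z)]addr0 residue_dvd [RHS]mod0z => /dvdz_mod0P.
rewrite dvdzE abszX /= => dv; have {}dv : (a * 2 ^ l = b * 2 ^ k)%N.
  case: (posnP `|(a * 2 ^ l)%N%:Z - (b * 2 ^ k)%N%:Z|%N) => [|d0]; first by lia.
  have := dvdn_leq d0 dv; move: ak bl; rewrite !expnS expnD.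
  have : (0 < 2 ^ k)%N by rewrite expn_gt0.
  have : (0 < 2 ^ l)%N by rewrite expn_gt0.
  by move: (2 ^ k)%N (2 ^ l)%N => K L *; nia.
apply/eqP; rewrite eqr_div ?expf_neq0 //.
by rewrite -!natrX -!natrM dv.
Qed.

Lemma floor2P u : is_floor2 u (floor2 u).
Proof. by have := floor2_ex u; exact: (@xgetPex _ 0 [set r | is_floor2 u r]). Qed.

Definition minimizes (R : realType) (f : int -> R) (i : int) : Prop :=
  forall j, f i <= f j.

Definition is_least_minimizer (R : realType) (f : int -> R) (i : int) : Prop :=
  minimizes f i /\ forall j, minimizes f j -> i <= j.

Definition least_minimizer (R : realType) (f : int -> R) : int :=
  xget 0 [set i | is_least_minimizer f i].

Lemma least_minimizerP (R : realType) (s x : R) (f : int -> R) : 0 < s ->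
  (forall i, f i = `|x - s * i%:~R|) -> is_least_minimizer f (least_minimizer f).
Proof.
move=> s0 fE; apply: (@xgetPex _ 0 [set i | is_least_minimizer f i]).
have B1 (i : int) : (i - 1)%:~R = i%:~R - 1 :> R by rewrite intrB.
have D1 (i : int) : (i + 1)%:~R = i%:~R + 1 :> R by rewrite intrD.
pose y := x / s; pose m := Num.ceil (y - 1 / 2).
have {}fE i : f i = s * `|y - i%:~R|.
  rewrite fE -{2}(gtr0_norm s0) -normrM; congr `|_|.
  by rewrite /y; field; rewrite gt_eqF.
have m1 : y - 1 / 2 <= m%:~R by exact: ceil_ge.
have m2 : m%:~R - 1 < y - 1 / 2 by rewrite -B1; exact: ceilB1_lt.
have ym : `|y - m%:~R| <= 1 / 2 by rewrite ler_norml; apply/andP; split; lra.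
exists m; split=> [j|j jmin].
  rewrite !fE ler_pM2l //; case: (ltrgtP j m) => [jm|jm|-> //].
    have : j%:~R <= m%:~R - 1 :> R by rewrite -B1 ler_int; lia.
    by move=> jm1; rewrite (le_trans ym) // ler_normr; apply/orP; left; lra.
  have : m%:~R + 1 <= j%:~R :> R by rewrite -D1 ler_int; lia.
  by move=> jm1; rewrite (le_trans ym) // ler_normr; apply/orP; right; lra.
rewrite leNgt; apply/negP => jm; have := jmin m; rewrite !fE ler_pM2l // leNgt.
have : j%:~R <= m%:~R - 1 :> R by rewrite -B1 ler_int; lia.
move=> jm1 /negP; apply; rewrite (le_lt_trans ym) // ltr_normr.
by apply/orP; left; lra.
Qed.

Definition b_fun0 (R : realType) (K : fieldExtType rat)
    (sigma_oo : {rmorphism K -> R}) (sigma_2 : {rmorphism K -> Q2})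
    (alpha : K) : rat :=
  let r := floor2 (sigma_2 alpha) in
  2 * (least_minimizer (fun i => `|sigma_oo alpha - 2 * i%:~R - ratr r|))%:~R + r.

Definition b_fun1 (R : realType) (K : fieldExtType rat)
    (sigma_oo : {rmorphism K -> R}) (sigma_2 : {rmorphism K -> Q2})
    (alpha : K) : rat :=
  let r := floor2 (sigma_2 alpha) in
  (least_minimizer (fun i => `|sigma_oo alpha - i%:~R - ratr r|))%:~R + r.

(* The index epsilon = 0, 1 is encoded as false, true. *)
Definition b_fun (R : realType) (K : fieldExtType rat)
    (sigma_oo : {rmorphism K -> R}) (sigma_2 : {rmorphism K -> Q2})
    (eps : bool) : K -> rat :=
  if eps then b_fun1 sigma_oo sigma_2 else b_fun0 sigma_oo sigma_2.

Definition F2 (R : realType) (K : fieldExtType rat)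
    (sigma_oo : {rmorphism K -> R}) (sigma_2 : {rmorphism K -> Q2})
    (eps : bool) (alpha : K) : option K :=
  let b : K := ratr (b_fun sigma_oo sigma_2 eps alpha) in
  if alpha == b then None else Some (1 / (alpha - b)).

(* alpha_n, which is None once the algorithm has halted *)
Fixpoint complete_quotient (R : realType) (K : fieldExtType rat)
    (sigma_oo : {rmorphism K -> R}) (sigma_2 : {rmorphism K -> Q2})
    (alpha : K) (n : nat) : option K :=
  if n is n'.+1 then
    obind (F2 sigma_oo sigma_2 (odd n'))
      (complete_quotient sigma_oo sigma_2 alpha n')
  else Some alpha.

Definition is_defined_at (R : realType) (K : fieldExtType rat)
    (sigma_oo : {rmorphism K -> R}) (sigma_2 : {rmorphism K -> Q2})
    (alpha : K) (n : nat) : bool :=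
  isSome (complete_quotient sigma_oo sigma_2 alpha n).

(* b_n(alpha), with the junk value 0 if alpha_n is undefined *)
Definition partial_quotient (R : realType) (K : fieldExtType rat)
    (sigma_oo : {rmorphism K -> R}) (sigma_2 : {rmorphism K -> Q2})
    (alpha : K) (n : nat) : rat :=
  if complete_quotient sigma_oo sigma_2 alpha n is Some a
  then b_fun sigma_oo sigma_2 (odd n) a else 0.

Definition cf_mx (b : rat) : 'M[rat]_2 :=
  \matrix_(i < 2, j < 2) nth 0 (nth [::] [:: [:: b; 1]; [:: 1; 0]] i) j.

Definition convergent_mx (R : realType) (K : fieldExtType rat)
    (sigma_oo : {rmorphism K -> R}) (sigma_2 : {rmorphism K -> Q2})
    (alpha : K) (n : nat) : 'M[rat]_2 :=
  \prod_(i < n.+1) cf_mx (partial_quotient sigma_oo sigma_2 alpha i).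

Definition p_ (R : realType) (K : fieldExtType rat)
    (sigma_oo : {rmorphism K -> R}) (sigma_2 : {rmorphism K -> Q2})
    (alpha : K) (n : nat) : rat :=
  convergent_mx sigma_oo sigma_2 alpha n 0 0.

Definition q_ (R : realType) (K : fieldExtType rat)
    (sigma_oo : {rmorphism K -> R}) (sigma_2 : {rmorphism K -> Q2})
    (alpha : K) (n : nat) : rat :=
  convergent_mx sigma_oo sigma_2 alpha n 1 0.

(* Main.v *)
(** Write [r_n = p_n - q_n alpha]; up to sign it is the product of the
    [alpha_i - b_i] for [i <= n], so it tends to 0 in R, while 2-adically it is
    of size at most [1 / |q_n|]. Let [N(p, q) = a p^2 + b p q + c q^2] be the
    integral quadratic form vanishing at [(alpha, 1)]. Since
    [N(p_n, q_n) = r_n (a r_n + q_n (2 a alpha + b))], the 2-adic bound shows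
    that [N(p_n, q_n)], a priori in Z[1/2], has a bounded power of 2 in its
    denominator. As it is nonzero, its real absolute value is bounded below;
    as [r_n] tends to 0, this forces [|q_n|] to be at least of order
    [1 / |r_n|], whence [|alpha - p_n / q_n| = O(r_n^2)]. *)
From HB Require Import structures.
Require Import Defs.
From mathcomp Require Import all_boot all_order all_algebra all_field.
From mathcomp Require Import boolp classical_sets reals topology normedtype.
From mathcomp Require Import sequences.
From mathcomp Require Import zify ring lra.
Import Order.TTheory GRing.Theory Num.Theory.
Import numFieldNormedType.Exports.
Local Open Scope classical_set_scope.
Local Open Scope ring_scope.

(** * The rings Z[1/2] and Z_2, and the real distance to a least minimizer *)

Definition dyadic : {pred rat} :=
  fun x => `[< exists m (i : int), x * 2 ^+ m = i%:~R >].

Lemma dyadicP x :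
  reflect (exists m (i : int), x * 2 ^+ m = i%:~R) (x \in dyadic).
Proof. exact: asboolP. Qed.

Lemma dyadic_subring : subring_closed dyadic.
Proof.
split=> [|x y /dyadicP[m [i xi]] /dyadicP[n [j yj]]|
         x y /dyadicP[m [i xi]] /dyadicP[n [j yj]]]; apply/dyadicP.
- by exists 0, 1; rewrite mulr1.
- exists (m + n)%N, (i * 2 ^+ n - j * 2 ^+ m).
  by rewrite intrB !intrM !rmorphXn /= -xi -yj exprD; ring.
- by exists (m + n)%N, (i * j); rewrite intrM -xi -yj exprD; ring.
Qed.

HB.instance Definition _ := GRing.isSubringClosed.Build rat dyadic
  dyadic_subring.

(** The image of Z_2 in Q_2 replaces a valuation: a 2-adic bound becomes membership after scaling by
    a power of 2, and the ultrametric inequality becomes closure as a subring. *)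
Definition Z2_frac : {pred Q2} := fun u => `[< exists z : Z2, u = tofrac z >].

Lemma Z2_fracP u : reflect (exists z : Z2, u = tofrac z) (u \in Z2_frac).
Proof. exact: asboolP. Qed.

Lemma Z2_frac_subring : subring_closed Z2_frac.
Proof.
split=> [|u v /Z2_fracP[x ->] /Z2_fracP[y ->]|
         u v /Z2_fracP[x ->] /Z2_fracP[y ->]]; apply/Z2_fracP.
- by exists 1; rewrite rmorph1.
- by exists (x - y); rewrite rmorphB.
- by exists (x * y); rewrite rmorphM.
Qed.

HB.instance Definition _ := GRing.isSubringClosed.Build Q2 Z2_frac
  Z2_frac_subring.

Lemma Q2_exp2_neq0 n : 2 ^+ n != 0 :> Q2.
Proof. exact/expf_neq0/Q2_2neq0. Qed.

Lemma Z2_frac_exp2 n : 2 ^+ n \in Z2_frac.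
Proof. by rewrite rpredX ?rpred_nat. Qed.

(** Z[1/2] and Z_2 meet in Z: if [x * 2 ^+ m] is an integer [i] and [x] is in Z_2, then [i] vanishes
    modulo [2 ^+ m]. *)
Lemma dyadic_Z2_frac_int (f : {rmorphism rat -> Q2}) (x : rat) :
  x \in dyadic -> f x \in Z2_frac -> x \is a Num.int.
Proof.
move=> /dyadicP[m [i xi]] /Z2_fracP[z xz].
have iz : i%:~R = 2 ^+ m * z + 0 :> Z2.
  apply/eqP; rewrite -tofrac_eq addr0; apply/eqP.
  rewrite rmorph_int rmorphM /= -xz tofrac2X.
  by rewrite -[LHS](rmorph_int f) -xi rmorphM rmorphXn rmorph_nat mulrC.
have /dvdz_mod0P/dvdzP[j ij] : (i %% 2 ^+ m)%Z = 0.
  by rewrite -residue_int iz residue_dvd /= mod0z.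
apply/intrP; exists j; apply: (@mulIf _ (2 ^+ m)); first by rewrite expf_neq0.
by rewrite xi ij intrM rmorphXn.
Qed.

Lemma Z2_frac_factor (u : Q2) : u \in Z2_frac -> u != 0 ->
  exists k v, [/\ u = 2 ^+ k * v, v \in Z2_frac & v^-1 \in Z2_frac].
Proof.
move=> /Z2_fracP[x ->]; rewrite tofrac_eq0 => /Z2_factor[k [y [z [-> zy _]]]].
exists k, (tofrac y); rewrite rmorphM /= tofrac2X; split=> //.
  by apply/Z2_fracP; exists y.
have zyF : tofrac z * tofrac y = 1 by rewrite -rmorphM zy rmorph1.
by apply/Z2_fracP; exists z; rewrite (mulr1_eq (y := tofrac z)) // mulrC.
Qed.

Lemma Q2_denominator (u : Q2) : exists s, 2 ^+ s * u \in Z2_frac.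
Proof.
have [k [a [z _ /eqP]]] := is_floor2E (floor2P u).
rewrite subr_eq => /eqP ->; exists k.
rewrite mulrDr [X in _ + X]mulrCA mulfV ?Q2_exp2_neq0 // mulr1.
rewrite rpredD ?rpred_nat // !rpredM ?Z2_frac_exp2 ?rpred_nat //.
by apply/Z2_fracP; exists z.
Qed.

Lemma floor2_dyadic u : floor2 u \in dyadic.
Proof.
have [k [a [z [_ ->] _]]] := is_floor2E (floor2P u).
by apply/dyadicP; exists k, a; rewrite divfK // expf_neq0.
Qed.

(** Only digits of positive index remain. The map [f] is arbitrary, so that composites with
    [sigma_2] are covered. *)
Lemma sub_floor2 (f : {rmorphism rat -> Q2}) u :
  u - f (floor2 u) \in Z2_frac.
Proof.
have [k [a [z [_ ->]]]] := is_floor2E (floor2P u).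
rewrite rmorphM fmorphV rmorphXn !rmorph_nat => ->.
by rewrite rpredM ?rpred_nat //; apply/Z2_fracP; exists z.
Qed.

Lemma least_minimizer_le (R : realType) (s x : R) (f : int -> R) : 0 < s ->
  (forall i, f i = `|x - s * i%:~R|) -> f (least_minimizer f) <= s / 2.
Proof.
move=> s0 fE; have [fmin _] := least_minimizerP s0 fE.
(* An integer nearest to [x / s]; by minimality it suffices to bound [f] there. *)
pose i := Num.floor (x / s + 1 / 2).
apply: le_trans (fmin i) _; rewrite fE.
have -> : x - s * i%:~R = s * (x / s - i%:~R) by field; rewrite gt_eqF.
rewrite normrM gtr0_norm // ler_pM2l // ler_norml.
have i1 : i%:~R <= x / s + 1 / 2 by exact: floor_le.
have i2 : x / s + 1 / 2 < i%:~R + 1.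
  by have /andP[_] := floor_itv (x / s + 1 / 2); rewrite intrD.
by apply/andP; split; lra.
Qed.

(** * Recurrences for products of continued fraction matrices *)

Lemma cf_prodS (b : nat -> rat) n (i : 'I_2) :
  let M n := \prod_(j < n.+1) cf_mx (b j) in
  M n.+1 i 0 = M n i 0 * b n.+1 + M n i 1 /\ M n.+1 i 1 = M n i 0.
Proof.
move=> M; rewrite /M big_ord_recr /= -/(M n) !mxE !big_ord_recl !big_ord0.
have -> : lift ord0 ord0 = 1 :> 'I_2 by apply: val_inj.
by rewrite !mxE /= !addr0 !mulr1 mulr0 addr0.
Qed.

Lemma cf_prod0 (b : nat -> rat) (i : 'I_2) :
  let M := \prod_(j < 1) cf_mx (b j) in
  M i 0 = (if i == 0 then b 0%N else 1) /\ M i 1 = (i == 0)%:R.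
Proof.
by rewrite /= big_ord1 !mxE; case: i => [[|[|i]] Hi].
Qed.

(** Each factor has determinant -1. This excludes that numerator and denominator of a convergent
    both vanish. *)
Lemma cf_prod_det_neq0 (b : nat -> rat) n :
  let M := \prod_(j < n.+1) cf_mx (b j) in M 0 0 * M 1 1 - M 0 1 * M 1 0 != 0.
Proof.
elim: n => [|n IHn] /=.
  have [-> ->] := cf_prod0 b 0; have [-> ->] := cf_prod0 b 1.
  by rewrite /= mulr0 mul1r sub0r oppr_eq0 oner_neq0.
have [-> ->] := cf_prodS b n 0; have [-> ->] := cf_prodS b n 1.
by apply: contra IHn => /eqP e; rewrite -oppr_eq0 -e; apply/eqP; ring.
Qed.

(** * An integral quadratic relation for alpha *)

(* If alpha is rational, the polynomial has to be a multiple of (X - alpha)^2: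
   another rational root could be one of the convergents. *)
Lemma integral_quadratic_relation (K : fieldExtType rat)
    (f : {rmorphism rat -> K}) (alpha : K) :
  \dim {:K} = 2%N -> exists a b c : int,
  a%:~R * alpha ^+ 2 + b%:~R * alpha + c%:~R = 0 /\
  forall p q : rat, f p - f q * alpha != 0 ->
    a%:~R * (f p + f q * alpha) + b%:~R * f q != 0.
Proof.
move=> dimK; have [[r ->]|irr] := pselect (exists r, alpha = f r).
  (* The coefficients of (dX - n)^2, where r = n/d. *)
  exists (denq r ^+ 2), (- (2 * numq r * denq r)), (numq r ^+ 2).
  have nE : (numq r)%:~R = f r * (denq r)%:~R.
    by rewrite -(rmorph_int f) numqE rmorphM rmorph_int.
  have d0 : (denq r)%:~R != 0 :> K.
    by rewrite -(rmorph_int f) fmorph_eq0 intr_eq0 denq_neq0.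
  rewrite !rmorphXn !rmorphN !rmorphM /= nE.
  split=> [|p q]; first by ring.
  apply: contraNN => /eqP e; have : (denq r)%:~R ^+ 2 * (f p - f q * f r) = 0.
    by rewrite -e; ring.
  by move/eqP; rewrite mulf_eq0 expf_eq0 /= (negPf d0).
have fZ (k : rat) x : k *: x = f k * x.
  by rewrite -mulr_algl -[k%:A]/(in_alg K k) !fmorph_eq_rat.
have dependent : ~~ free [tuple 1; alpha; alpha ^+ 2].
  apply/negP => /eqP; have := dimvS (subvf <<[tuple 1; alpha; alpha ^+ 2]>>).
  by rewrite dimK => /[swap] ->.
have [c [b [a [abc0 abcE]]]] : exists c b a : int,
    [|| c != 0, b != 0 | a != 0] /\
    c%:~R + b%:~R * alpha + a%:~R * alpha ^+ 2 = 0.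
  move/freeP/existsNP: dependent => [k /not_implyP[]].
  rewrite !big_ord_recl big_ord0 /= addr0 !fZ.
  set z := k _; set y := k _; set x := k _ => e k0.
  pose dx := denq x; pose dy := denq y; pose dz := denq z.
  have nE (r : rat) : (numq r)%:~R = f r * (denq r)%:~R.
    by rewrite -(rmorph_int f) numqE rmorphM rmorph_int.
  (* The linear relation is multiplied by the product of the three denominators. *)
  exists (numq z * dy * dx), (numq y * dz * dx), (numq x * dz * dy); split.
    apply: contra_notT k0; rewrite !negb_or !negbK !mulf_eq0.
    rewrite !numq_eq0 !denq_eq0 !orbF.
    case/and3P => /eqP z0 /eqP y0 /eqP x0 [[|[|[|i]]] Hi] //.
    - by rewrite -[RHS]z0; congr (k _); apply: val_inj.
    - by rewrite -[RHS]y0; congr (k _); apply: val_inj.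
    - by rewrite -[RHS]x0; congr (k _); apply: val_inj.
  rewrite !rmorphM /= !nE; set d := dx%:~R * dy%:~R * dz%:~R : K.
  transitivity (d * (f z * 1 + (f y * alpha + f x * alpha ^+ 2))).
    by rewrite /d /dx /dy /dz; ring.
  by rewrite e mulr0.
exists a, b, c; split=> [|p q]; first by rewrite -abcE; ring.
apply: contraNN => /eqP e.
have rat_int (m : int) : m%:~R = f m%:~R by rewrite rmorph_int.
(* The equation [e] makes alpha rational, except when [a] or [q] is 0. If [a] is 0, the quadratic
   relation itself makes alpha rational or has only zero coefficients; if only [q] is 0, then [p] is
   0 too. *)
have [a0|a0] := eqVneq a 0.
  have [b0|b0] := eqVneq b 0.
    move: abcE abc0; rewrite a0 b0 !mul0r !addr0 eqxx orbF.
    by rewrite rat_int => /eqP; rewrite fmorph_eq0 intr_eq0 => ->.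
  case: irr; exists (- c%:~R / b%:~R); rewrite fmorph_div rmorphN !rmorph_int.
  have bK : b%:~R != 0 :> K by rewrite rat_int fmorph_eq0 intr_eq0.
  apply: (mulIf bK); rewrite divfK //; move: abcE.
  by rewrite a0 mul0r addr0 addrC mulrC => /eqP;
    rewrite addr_eq0 => /eqP.
have aK : a%:~R != 0 :> K by rewrite rat_int fmorph_eq0 intr_eq0.
have [q0|q0] := eqVneq q 0.
  move: e; rewrite q0 rmorph0 mul0r mulr0 !addr0 subr0 => /eqP.
  by rewrite mulf_eq0 (negPf aK).
case: irr; exists (- (b%:~R * q + a%:~R * p) / (a%:~R * q)).
rewrite fmorph_div rmorphN rmorphD !rmorphM !rmorph_int.
have fq : f q != 0 by rewrite fmorph_eq0.
apply: (mulIf (mulf_neq0 aK fq)); rewrite divfK ?mulf_neq0 //.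
by apply/eqP; rewrite -addr_eq0 -e; apply/eqP; ring.
Qed.

(** * Remainders and their 2-adic size *)

(** With r_n = p_n - q_n a_0 and r_{-1} = 1, induction gives r_n a_{n+1} = - r_{n-1}; inserting this
    in r_{n+1} = b_{n+1} r_n + r_{n-1} gives the claim. The bound [N] admits the halting case. *)
Lemma cf_remainder (K : fieldType) (f : {rmorphism rat -> K}) (a : nat -> K)
    (b : nat -> rat) N :
  (forall n, (n < N)%N -> (a n - f (b n)) * a n.+1 = 1) ->
  forall n, (n <= N)%N -> let M := \prod_(j < n.+1) cf_mx (b j) in
  f (M 0 0) - f (M 1 0) * a 0%N =
  (f (b n) - a n) * (f (M 0 1) - f (M 1 1) * a 0%N).
Proof.
move=> aE; elim=> [_|n IHn nN] /=.
  have [-> ->] := cf_prod0 b 0; have [-> ->] := cf_prod0 b 1.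
  by rewrite /= rmorph0 !rmorph1; ring.
have := IHn (ltnW nN) => /=.
have [-> ->] := cf_prodS b n 0; have [-> ->] := cf_prodS b n 1.
rewrite !rmorphD !rmorphM.
set p := f (_ 0 0); set q := f (_ 1 0).
set p' := f (_ 0 1); set q' := f (_ 1 1) => e.
have : (f (b n) - a n) * a n.+1 = -1 by rewrite -(aE n nN); ring.
move=> e1; have : (p - q * a 0%N) * a n.+1 = - (p' - q' * a 0%N).
  by rewrite e mulrAC e1; ring.
have -> : p * f (b n.+1) + p' - (q * f (b n.+1) + q') * a 0%N =
  f (b n.+1) * (p - q * a 0%N) + (p' - q' * a 0%N) by ring.
by move/eqP; rewrite -eqr_oppLR => /eqP <-; ring.
Qed.

Lemma mulf_cancelr (F : fieldType) (E K v L : F) : E != 0 -> K != 0 ->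
  - (K * v) * L / (E * K) = - (v * (L / E)).
Proof. by move=> E0 K0; field; rewrite E0 K0. Qed.

(** The form vanishing at (x, 1), with its factors grouped so that each is 2-adically integral: [E]
    is balanced between [p - q * x] and [q], and [S] clears the denominator of [x]. *)
Lemma quadratic_form_factor (F : fieldType) (E S a b p q x : F) : E != 0 ->
  S * (a * p ^+ 2 + b * p * q + - (a * x ^+ 2 + b * x) * q ^+ 2) =
  (p - q * x) / E * (a * E * E * S * ((p - q * x) / E)
    + (E * q) * (2 * a * (S * x) + S * b)).
Proof. by move=> E0; field. Qed.

(* [2 ^ e] is the 2-adic absolute value of [a 1 * .. * a n]. *)
Lemma cf_Z2_frac (f : {rmorphism rat -> Q2}) (a : nat -> Q2) (b : nat -> rat) :
  (forall n, (a n - f (b n)) * a n.+1 = 1) ->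
  (forall n, a n - f (b n) \in Z2_frac) ->
  forall n, let M := \prod_(j < n.+1) cf_mx (b j) in exists e,
  2 ^+ e * f (M 1 0) \in Z2_frac /\
  (f (M 0 0) - f (M 1 0) * a 0%N) / 2 ^+ e \in Z2_frac.
Proof.
move=> aE abZ n /=.
have remE m := cf_remainder _ f a b m (fun k _ => aE k) m (leqnn m).
(* Strengthened for induction to the second column, that is to the preceding denominator and
   remainder; the latest remainder has one more integral factor. *)
suff [e [qe q'e Le]] : let M := \prod_(j < n.+1) cf_mx (b j) in exists e,
    [/\ 2 ^+ e * f (M 1 0) \in Z2_frac, 2 ^+ e * f (M 1 1) \in Z2_frac &
        (f (M 0 1) - f (M 1 1) * a 0%N) / 2 ^+ e \in Z2_frac].
  exists e; split=> //; rewrite remE -mulrA rpredM //.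
  by rewrite -opprB rpredN.
elim: n => [|n /= [e [qe q'e Le]]] /=.
  exists 0%N; have [_ ->] := cf_prod0 b 0; have [-> ->] := cf_prod0 b 1.
  rewrite /= expr0 invr1 !mulr1 !mul1r rmorph0 rmorph1 mul0r subr0.
  by split; rewrite ?rpred0 ?rpred1.
have := remE n => /=.
have [_ ->] := cf_prodS b n 0; have [-> ->] := cf_prodS b n 1 => ->.
have ab0 : a n - f (b n) != 0.
  by apply/eqP => e0; have /eqP := aE n; rewrite e0 mul0r eq_sym oner_eq0.
(* As [v] is a unit, [a n.+1] has absolute value [2 ^+ k]. Hence [e] grows by [k], and [2 ^+ k]
   clears the denominator of [b n.+1], which differs from [a n.+1] by an integral element. *)
have [k [v [abE vZ v1Z]]] := Z2_frac_factor _ (abZ n) ab0.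
have v0 : v != 0 by apply: contraNneq ab0 => v0; rewrite abE v0 mulr0.
have k0 := Q2_exp2_neq0 k; have e0 := Q2_exp2_neq0 e.
have kb : 2 ^+ k * f (b n.+1) \in Z2_frac.
  have ka : 2 ^+ k * a n.+1 = v^-1.
    by apply: (mulfI v0); rewrite mulfV // -[RHS](aE n) abE; ring.
  have -> : 2 ^+ k * f (b n.+1) = v^-1 - 2 ^+ k * (a n.+1 - f (b n.+1)).
    by rewrite -ka; ring.
  by rewrite rpredB // rpredM ?Z2_frac_exp2.
exists (e + k)%N; rewrite exprD; split.
- rewrite rmorphD rmorphM.
  set q := f (_ 1 0); set q' := f (_ 1 1).
  have -> : 2 ^+ e * 2 ^+ k * (q * f (b n.+1) + q') =
    2 ^+ e * q * (2 ^+ k * f (b n.+1)) + 2 ^+ k * (2 ^+ e * q') by ring.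
  by rewrite rpredD // rpredM // Z2_frac_exp2.
- by rewrite [2 ^+ e * _]mulrC -mulrA rpredM ?Z2_frac_exp2.
- by rewrite -opprB abE mulf_cancelr // rpredN rpredM.
Qed.

(** The value lies in Z[1/2], and in Z_2 by the factorization. The exponent [s] is tied to [x]
    alone, not to [p], [q] or [e]. *)
Lemma quadratic_form_int (f : {rmorphism rat -> Q2}) (x : Q2) (a b c : int)
    (p q : rat) e s :
  a%:~R * x ^+ 2 + b%:~R * x + c%:~R = 0 ->
  p \in dyadic -> q \in dyadic -> 2 ^+ s * x \in Z2_frac ->
  2 ^+ e * f q \in Z2_frac -> (f p - f q * x) / 2 ^+ e \in Z2_frac ->
  2 ^+ s * (a%:~R * p ^+ 2 + b%:~R * p * q + c%:~R * q ^+ 2) \is a Num.int.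
Proof.
move=> abc pd qd xs qe we; apply: (dyadic_Z2_frac_int f).
  by rewrite !(rpredM, rpredD, rpredX) ?rpred_int ?rpred_nat // (rpred1 dyadic).
move: abc => /eqP; rewrite addrC addr_eq0 => /eqP cE.
rewrite !(rmorphXn, rmorph_nat, rmorph_int, rmorphM, rmorphD) /= cE.
have e0 := Q2_exp2_neq0 e.
rewrite (quadratic_form_factor _ (2 ^+ e)) //.
apply: rpredM => //; apply: rpredD; apply: rpredM => //.
  by rewrite !rpredM ?rpred_int ?Z2_frac_exp2.
by rewrite rpredD // rpredM ?rpred_int ?Z2_frac_exp2 // rpredM //;
  rewrite ?rpred_int ?rpred_nat.
Qed.

(** * Real estimates *)

(* The two inequalities exclude [q = 0]. *)
Lemma quotient_error_le (R : realFieldType) (x p q A M C : R) :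
  let d := `|p - q * x| in 0 <= C ->
  1 <= C * d * (A * d + `|q| * M) -> 2 * (C * A * d ^+ 2) < 1 ->
  `|p / q - x| <= 2 * C * M * d ^+ 2.
Proof.
move=> d C0 h1 h2; have [q0|q0] := eqVneq q 0.
  by exfalso; move: h1; rewrite q0 normr0; nra.
have -> : p / q - x = (p - q * x) / q by field.
have qp : 0 < `|q| by rewrite normr_gt0.
rewrite normrM normfV ler_pdivrMr // -/d.
have d0 : 0 <= d by exact: normr_ge0.
(* The term in [d ^+ 2] is below 1/2 and is absorbed by the left side. *)
have h3 : 1 <= 2 * (C * d * `|q| * M) by lra.
have := ler_wpM2l d0 h3; rewrite mulr1; lra.
Qed.

Lemma geometric_half_uphalf_le (R : realFieldType) n :
  (2^-1 : R) ^+ uphalf n * 2^-1 ^+ uphalf n <= 2^-1 ^+ n.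
Proof.
have /andP[h0 h1] : 0 <= (2^-1 : R) <= 1 by lra.
rewrite -exprD addnn; apply: ler_wiXn2l => //.
by rewrite uphalf_half doubleD -{1}(odd_double_half n) leq_add2r; case: (odd n).
Qed.

(** * Partial quotients of the algorithm and the halting case *)

Section Algorithm.

Variables (R : realType) (K : fieldExtType rat).
Variables (sigma_oo : {rmorphism K -> R}) (sigma_2 : {rmorphism K -> Q2}).
Local Notation b_fun := (b_fun sigma_oo sigma_2).

Lemma b_fun_dyadic eps x : b_fun eps x \in dyadic.
Proof.
by case: eps; rewrite rpredD ?floor2_dyadic ?rpred_int //=;
  rewrite rpredM ?rpred_int ?rpred_nat.
Qed.

Lemma sub_b_fun_Z2_frac (f : {rmorphism rat -> Q2}) eps x :
  sigma_2 x - f (b_fun eps x) \in Z2_frac.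
Proof.
have h (m : int) : sigma_2 x - f (m%:~R + floor2 (sigma_2 x)) \in Z2_frac.
  rewrite rmorphD rmorph_int opprD addrCA addrC.
  by rewrite rpredB ?sub_floor2 ?rpred_int.
case: eps => /=; first exact: h.
by rewrite /b_fun0 -[2]/(2%:~R : rat) -intrM; exact: h.
Qed.

(** The bound is half the spacing of the admissible values, which is 2 for even and 1 for odd steps;
    only odd steps contract. *)
Lemma sub_b_fun_le (eps : bool) x :
  `|sigma_oo x - ratr (b_fun eps x)| <= 2^-1 ^+ eps.
Proof.
case: eps => /=.
  rewrite /b_fun1 rmorphD /= ratr_int opprD addrA expr1 -[2^-1]mul1r.
  apply: (least_minimizer_le _ 1 (sigma_oo x - ratr (floor2 (sigma_2 x)))
    (fun i => `|sigma_oo x - i%:~R - ratr (floor2 (sigma_2 x))|)) => // i.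
  by congr (`|_|); ring.
rewrite /b_fun0 rmorphD rmorphM /= ratr_int ratr_nat opprD addrA expr0.
rewrite -[leRHS](@divff _ 2) ?pnatr_eq0 //.
apply: (least_minimizer_le _ 2 (sigma_oo x - ratr (floor2 (sigma_2 x)))
  (fun i => `|sigma_oo x - 2 * i%:~R - ratr (floor2 (sigma_2 x))|)) => // i.
by congr (`|_|); ring.
Qed.

Variables (f : {rmorphism rat -> K}) (alpha : K).

(** The default 0 stands for alpha_n after halting; the lemmas about [a] assume definedness at the
    indices they use. *)
Let a n := odflt 0 (complete_quotient sigma_oo sigma_2 alpha n).
Let b := partial_quotient sigma_oo sigma_2 alpha.

Lemma is_defined_atW n : is_defined_at sigma_oo sigma_2 alpha n.+1 ->
  is_defined_at sigma_oo sigma_2 alpha n.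
Proof. by rewrite /is_defined_at /=; case: complete_quotient. Qed.

Lemma partial_quotientE n : is_defined_at sigma_oo sigma_2 alpha n ->
  b n = b_fun (odd n) (a n).
Proof.
by rewrite /is_defined_at /b /a /partial_quotient; case: complete_quotient.
Qed.

Lemma complete_quotientS n : is_defined_at sigma_oo sigma_2 alpha n.+1 ->
  (a n - f (b n)) * a n.+1 = 1.
Proof.
move=> def; rewrite (partial_quotientE _ (is_defined_atW _ def)).
move: def; rewrite /is_defined_at /a /=.
case: complete_quotient => [x|] //=; rewrite /F2 fmorph_eq_rat.
by case: eqVneq => //= xb _; rewrite mul1r mulfV // subr_eq0.
Qed.

Lemma complete_quotient_halt n : is_defined_at sigma_oo sigma_2 alpha n ->
  ~~ is_defined_at sigma_oo sigma_2 alpha n.+1 -> a n = f (b n).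
Proof.
move=> def; rewrite (partial_quotientE _ def); move: def.
rewrite /is_defined_at /a /=.
case: complete_quotient => [x|] //=; rewrite /F2 fmorph_eq_rat.
by case: eqP.
Qed.

Lemma partial_quotient_dyadic n : b n \in dyadic.
Proof.
rewrite /b /partial_quotient; case: complete_quotient => [x|].
  exact: b_fun_dyadic.
by rewrite (rpred0 dyadic).
Qed.

Lemma convergent_dyadic n i j :
  convergent_mx sigma_oo sigma_2 alpha n i j \in dyadic.
Proof.
suff : convergent_mx sigma_oo sigma_2 alpha n i 0 \in dyadic /\
       convergent_mx sigma_oo sigma_2 alpha n i 1 \in dyadic.
  case=> h0 h1; case: j => [[|[|j]] Hj] //.
    by rewrite (_ : Ordinal Hj = 0) //; apply: val_inj.
  by rewrite (_ : Ordinal Hj = 1) //; apply: val_inj.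
rewrite /convergent_mx; elim: n => [|n [h0 h1]].
  have [-> ->] := cf_prod0 b i; split; last by rewrite rpred_nat.
  by case: ifP => _; rewrite ?(rpred1 dyadic) ?partial_quotient_dyadic.
have [-> ->] := cf_prodS b n i; split=> //.
by rewrite rpredD // rpredM ?partial_quotient_dyadic.
Qed.

Local Notation p n := (p_ sigma_oo sigma_2 alpha n).
Local Notation q n := (q_ sigma_oo sigma_2 alpha n).

(** At the last step [a N] equals [b N], so the remainder vanishes; the determinant excludes a zero
    denominator. *)
Lemma convergent_halt N : is_defined_at sigma_oo sigma_2 alpha N ->
  ~~ is_defined_at sigma_oo sigma_2 alpha N.+1 -> alpha = f (p N / q N).
Proof.
move=> def ndef; have aE n : (n < N)%N -> (a n - f (b n)) * a n.+1 = 1.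
  move=> nN; apply: complete_quotientS.
  elim: N nN def {ndef} => // N IHN; rewrite ltnS leq_eqVlt.
  by case/orP=> [/eqP -> //|/IHN h /is_defined_atW].
have /= := cf_remainder _ f a b N aE N (leqnn N).
rewrite (complete_quotient_halt _ def ndef) subrr mul0r => /eqP.
rewrite subr_eq0 -/(convergent_mx sigma_oo sigma_2 alpha N) => /eqP pqE.
have [q0|q0] := eqVneq (q N) 0.
  have p0 : p N = 0.
    by apply/eqP; rewrite -(fmorph_eq0 f) pqE -/(q N) q0 rmorph0 mul0r.
  have := cf_prod_det_neq0 b N.
  by rewrite /= -/(convergent_mx sigma_oo sigma_2 alpha N) -/(p N) -/(q N);
    rewrite p0 q0 mul0r mulr0 subrr eqxx.
have fq0 : f (q N) != 0 by rewrite fmorph_eq0.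
by rewrite fmorph_div; apply: (mulfI fq0); rewrite -[RHS]mulrC divfK.
Qed.

(** * Bounds when the algorithm never halts *)

Hypothesis defined : forall n, is_defined_at sigma_oo sigma_2 alpha n.

Let aE n : (a n - f (b n)) * a n.+1 = 1.
Proof. exact: complete_quotientS. Qed.

(** Up to sign a product of differences [a i - f (b i)], each invertible with inverse [a i.+1]. *)
Lemma remainder_neq0 n : f (p n) - f (q n) * alpha != 0.
Proof.
have ab0 m : f (b m) - a m != 0.
  apply: contra_eq_neq (aE m) => /eqP; rewrite subr_eq0 => /eqP ->.
  by rewrite subrr mul0r eq_sym oner_neq0.
have /= remE m := cf_remainder _ f a b m (fun k _ => aE k) m (leqnn m).
rewrite (remE n) mulf_neq0 ?ab0 //; elim: n => [|n IHn].
  have [_ ->] := cf_prod0 b 0; have [_ ->] := cf_prod0 b 1.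
  by rewrite /= rmorph0 rmorph1 mul0r subr0 oner_neq0.
have [_ ->] := cf_prodS b n 0; have [_ ->] := cf_prodS b n 1.
by rewrite (remE n) mulf_neq0 ?ab0.
Qed.

(** There are [uphalf n] odd indices up to [n], each contributing a factor 1/2. *)
Lemma remainder_le n :
  `|ratr (p n) - ratr (q n) * sigma_oo alpha| <= 2^-1 ^+ uphalf n.
Proof.
have fE x : sigma_oo (f x) = ratr x by rewrite -(fmorph_eq_rat (sigma_oo \o f)).
rewrite -!fE -rmorphM -rmorphB.
have /= remE m := cf_remainder _ f a b m (fun k _ => aE k) m (leqnn m).
have ab_le m : `|sigma_oo (f (b m) - a m)| <= 2^-1 ^+ odd m.
  by rewrite -normrN -rmorphN opprB rmorphB fE partial_quotientE //;
    rewrite sub_b_fun_le.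
elim: n => [|n IHn].
  rewrite (remE 0); have [_ ->] := cf_prod0 b 0; have [_ ->] := cf_prod0 b 1.
  rewrite /= rmorph0 rmorph1 mul0r subr0 mulr1; exact: (ab_le 0%N).
rewrite (remE n.+1).
have [_ ->] := cf_prodS b n 0; have [_ ->] := cf_prodS b n 1.
rewrite rmorphM normrM -[uphalf n.+1]/(n./2.+1).
have -> : n./2.+1 = (odd n.+1 + uphalf n)%N.
  by rewrite uphalf_half /=; case: odd; lia.
by rewrite exprD ler_pM ?ab_le.
Qed.

(** One [s], clearing the 2-adic denominator of alpha, serves for all [n]. *)
Lemma norm_form_int : exists s, forall (A B C : int),
  A%:~R * alpha ^+ 2 + B%:~R * alpha + C%:~R = 0 -> forall n,
  2 ^+ s * (A%:~R * p n ^+ 2 + B%:~R * p n * q n + C%:~R * q n ^+ 2)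
    \is a Num.int.
Proof.
have [s sZ] := Q2_denominator (sigma_2 alpha).
exists s => A B C ABC n.
have [|m|e [eq er]] := cf_Z2_frac (sigma_2 \o f) (sigma_2 \o a) b _ _ n.
- by move=> m /=; rewrite -rmorphB -rmorphM aE rmorph1.
- by rewrite /= partial_quotientE //; exact: (sub_b_fun_Z2_frac (sigma_2 \o f)).
apply: (quadratic_form_int (sigma_2 \o f) (sigma_2 alpha) A B C _ _ e s) => //.
- have := congr1 sigma_2 ABC.
  by rewrite !(rmorphD, rmorphM, rmorphXn, rmorph_int, rmorph0).
- exact: convergent_dyadic.
- exact: convergent_dyadic.
Qed.

Lemma convergent_error_le (A B C : int) s :
  A%:~R * alpha ^+ 2 + B%:~R * alpha + C%:~R = 0 ->
  (forall p q : rat, f p - f q * alpha != 0 ->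
    A%:~R * (f p + f q * alpha) + B%:~R * f q != 0) ->
  (forall n, 2 ^+ s * (A%:~R * p n ^+ 2 + B%:~R * p n * q n + C%:~R * q n ^+ 2)
    \is a Num.int) ->
  forall n, 2 * (2 ^+ s * `|A%:~R| * 2^-1 ^+ n) < 1 :> R ->
  `|ratr (p n / q n) - sigma_oo alpha| <=
  2 * 2 ^+ s * `|2 * A%:~R * sigma_oo alpha + B%:~R| * 2^-1 ^+ n.
Proof.
move=> ABC nz int_form n small.
have fE x : sigma_oo (f x) = ratr x by rewrite -(fmorph_eq_rat (sigma_oo \o f)).
set x := sigma_oo alpha; set P : R := ratr (p n); set Q : R := ratr (q n).
set M := `|2 * _ * _ + _|.
pose N := A%:~R * p n ^+ 2 + B%:~R * p n * q n + C%:~R * q n ^+ 2.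
have cE : C%:~R = - (A%:~R * alpha ^+ 2 + B%:~R * alpha).
  by apply/eqP; rewrite -addr_eq0 addrC ABC.
have NE : f N = (f (p n) - f (q n) * alpha) *
    (A%:~R * (f (p n) + f (q n) * alpha) + B%:~R * f (q n)).
  by rewrite /N !(rmorphXn, rmorph_int, rmorphM, rmorphD) /= cE; ring.
have N0 : N != 0.
  by rewrite -(fmorph_eq0 f) NE mulf_neq0 ?nz ?remainder_neq0.
have NR : ratr N = (P - Q * x) *
    (A%:~R * (P - Q * x) + Q * (2 * A%:~R * x + B%:~R)).
  rewrite -fE NE !(rmorphM, rmorphD, rmorphN, rmorph_int) /= !fE.
  by rewrite -/P -/Q -/x; ring.
(* A nonzero integer has absolute value at least 1. *)
have N1 : 1 <= 2 ^+ s * `|ratr N : R|.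
  have : 1 <= `|2 ^+ s * N|.
    apply: norm_intr_ge1; first exact: int_form.
    by rewrite mulf_neq0 // expf_neq0.
  rewrite -(ler_rat R) rmorph1 => /le_trans; apply.
  by rewrite ratr_norm rmorphM rmorphXn /= ratr_nat normrM normrX normr_nat.
have d_le : `|P - Q * x| ^+ 2 <= 2^-1 ^+ n.
  apply: le_trans (geometric_half_uphalf_le R n).
  by rewrite expr2 ler_pM ?remainder_le.
have M0 : 0 <= M by exact: normr_ge0.
have s0 : 0 <= 2 ^+ s :> R by rewrite exprn_ge0.
rewrite fmorph_div -/P -/Q.
apply: (le_trans (quotient_error_le _ x P Q `|A%:~R| M (2 ^+ s) _ _ _)) => //.
- apply: (le_trans N1); rewrite NR normrM mulrA.
  apply: ler_wpM2l; first by rewrite mulr_ge0.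
  by rewrite (le_trans (ler_normD _ _)) // !normrM.
- apply: le_lt_trans small; rewrite ler_wpM2l // ler_wpM2l //.
  by rewrite mulr_ge0.
- by rewrite ler_wpM2l // mulr_ge0 // mulr_ge0.
Qed.

End Algorithm.

(** * Convergence from the geometric error bound *)

Theorem corollary3p14 (R : realType) (K : fieldExtType rat)
    (quadratic : \dim {:K} = 2%N)
    (sigma_oo : {rmorphism K -> R}) (sigma_2 : {rmorphism K -> Q2})
    (alpha : K) :
  let conv (n : nat) : R :=
    ratr (p_ sigma_oo sigma_2 alpha n / q_ sigma_oo sigma_2 alpha n) in
  ((forall n, is_defined_at sigma_oo sigma_2 alpha n) ->
     conv n @[n --> \oo] --> sigma_oo alpha) /\
  (forall N, is_defined_at sigma_oo sigma_2 alpha N ->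
     ~~ is_defined_at sigma_oo sigma_2 alpha N.+1 ->
     conv N = sigma_oo alpha).
Proof.
move=> conv; split=> [defined|N def ndef]; last first.
  rewrite (convergent_halt _ _ _ _ (in_alg K) alpha N def ndef).
  by rewrite -[RHS]/((sigma_oo \o in_alg K) _) fmorph_eq_rat.
have [A [B [C [ABC nz]]]] :=
  integral_quadratic_relation K (in_alg K) alpha quadratic.
have [s int_form] := norm_form_int _ _ _ sigma_2 (in_alg K) alpha defined.
have err := convergent_error_le _ _ _ sigma_2 _ alpha defined A B C s ABC nz
  (int_form A B C ABC).
have half1 : `|2^-1 : R| < 1 by rewrite ger0_norm; lra.
have geo0 c : c * 2^-1 ^+ n @[n --> \oo] --> (0 : R).
  exact: (cvg_geometric c half1).
apply/cvgrPdist_le => e e0.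
(* Eventually the smallness condition of [convergent_error_le] holds; the next limit makes its error
   bound at most [e]. *)
have /cvgrPdist_lt/(_ 1 ltr01) := geo0 (2 * (2 ^+ s * `|A%:~R|)).
have /cvgrPdist_le/(_ e e0) :=
  geo0 (2 * 2 ^+ s * `|2 * A%:~R * sigma_oo alpha + B%:~R|).
apply: filterS2 => n; rewrite !sub0r !normrN => small_err small.
rewrite distrC (le_trans (err n _)) //.
  by rewrite mulrA; apply: le_lt_trans small; exact: ler_norm.
by apply: le_trans small_err; exact: ler_norm.
Qed.
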